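(* Let $n>0$ and $d\ge 1$ be integers, let $0<\alpha\le 1$, and let $\delta\in\left(e^{-n/4},\tfrac14\right)$. Then there exists a set $\mathcal{F}$ of probability distributions over $\mathbb{R}^d$ such that each $\mathcal{D}\in\mathcal{F}$ satisfies the weak moment condition with parameter $\alpha$, and such that for any estimator $\hat\mu$ there is a $\mathcal{D}\in\mathcal{F}$ for which $$\mathbb{P}\left\{\|\hat\mu(\mathbf{X})-\mu(\mathcal{D})\|\ge\frac{1}{24}\cdot\max\left(\left(\frac{d}{n}\right)^{\frac{\alpha}{1+\alpha}},\ \sqrt{\frac{d}{n}},\ \left(\frac{\log (2/\delta)}{n}\right)^{\frac{\alpha}{1+\alpha}}\right)\right\}\ge\delta,$$ where $\mathbf{X}=(X_1,\dots,X_n)$ is generated i.i.d. from $\mathcal{D}$.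
   Context: $\|\cdot\|$ is the Euclidean norm and $\mu(\mathcal{D})$ is the mean of $\mathcal{D}$. A distribution $\mathcal{D}$ on $\mathbb{R}^d$ with mean $\mu$ satisfies the weak moment condition with parameter $\alpha\in[0,1]$ if $\mathbb{E}_{X\sim\mathcal{D}}\left[|\langle v,X-\mu\rangle|^{1+\alpha}\right]\le 1$ for every $v\in\mathbb{R}^d$ with $\|v\|=1$. An estimator is a measurable map $\hat\mu:(\mathbb{R}^d)^n\to\mathbb{R}^d$. The set $\mathcal{F}$ may depend on $n,d,\alpha,\delta$. *)

(* Defs.v *)
From HB Require Import structures.
From mathcomp Require Import all_boot all_order all_algebra.
From mathcomp Require Import all_classical all_reals all_analysis.

Set Implicit Arguments.
Unset Strict Implicit.
Unset Printing Implicit Defensive.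

Import Order.TTheory GRing.Theory Num.Theory.
Import numFieldNormedType.Exports.

Local Open Scope classical_set_scope.
Local Open Scope ring_scope.

(* R^d is 'rV[R]_d with its Borel sigma-algebra. *)
HB.instance Definition _ (R : realType) (d : nat) :=
  @isMeasurable.Build (sigma_display (@open 'rV[R]_d)) 'rV[R]_d
    <<s (@open 'rV[R]_d) >> (@sigma_algebra0 _ setT _)
    (@sigma_algebraC _ _) (@sigma_algebra_bigcup _ setT _).

Definition dotr (R : realType) (d : nat) (u v : 'rV[R]_d) : R :=
  \sum_(i < d) u ord0 i * v ord0 i.

(* The library norm `|x| on 'rV[R]_d is the sup norm, hence this one. *)
Definition enorm (R : realType) (d : nat) (x : 'rV[R]_d) : R :=
  Num.sqrt (dotr x x).

Section iid.
Local Open Scope ereal_scope.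
Context (dT : measure_display) (T : measurableType dT) (R : realType).

Definition tcons (n : nat) (p : T * n.-tuple T) : n.+1.-tuple T :=
  [tuple of p.1 :: p.2].

Lemma measurable_tcons (n : nat) : measurable_fun [set: T * n.-tuple T] (@tcons n).
Proof. exact: (measurable_cons measurable_fst measurable_snd). Qed.

HB.instance Definition _ (n : nat) :=
  isMeasurableFun.Build _ _ _ _ (@tcons n) (@measurable_tcons n).

(* The n-fold product measure P (x) ... (x) P, i.e. the law of an i.i.d. sample
   (X_1, ..., X_n) from P; n.-tuple T carries the product sigma-algebra. *)
Fixpoint iid (P : probability T R) (n : nat) : probability (n.-tuple T) R :=
  match n with
  | 0 => \d_[tuple] : probability (0.-tuple T) R
  | m.+1 => distribution (P \x iid P m) (@tcons m) : probability (m.+1.-tuple T) R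
  end.

Lemma iid_box (P : probability T R) (n : nat) (A : 'I_n -> set T) :
  (forall i, measurable (A i)) ->
  iid P n [set x | forall i, A i (tnth x i)] = \prod_(i < n) P (A i).
Proof.
elim: n A => [|n IH] A mA.
  rewrite big_ord0 /= diracE mem_set//= => -[].
  by [].
rewrite big_ord_recl /= -IH; last by move=> i; exact: mA.
rewrite /distribution /pushforward -product_measure1E//.
- congr (product_measure1 _ _ _); apply/seteqP; split => -[x t] /=.
    move=> H; split=> [|i]; first by have := H ord0.
    by have := H (lift ord0 i); rewrite tnthS.
  move=> [Ax At] i; have [->//|i0] := eqVneq i ord0.
  by case: (unliftP ord0 i) i0 => [j ->|->]; rewrite ?eqxx// tnthS.
- rewrite [X in measurable X](_ : _ = \bigcap_(i in [set: 'I_n])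
    ((@tnth n T ^~ i) @^-1` A (lift ord0 i))); last first.
    by apply/seteqP; split => x /= H i; [move=> _|]; exact: H.
  apply: fin_bigcap_measurable => // i _.
  by rewrite -[X in measurable X]setTI; apply: measurable_tnth.
Qed.

End iid.

Section moments.
Context (R : realType) (d : nat).
Implicit Type D : probability 'rV[R]_d R.

Definition has_mean D : Prop :=
  forall i : 'I_d, D.-integrable [set: 'rV[R]_d] (fun x => (x ord0 i)%:E).

Definition mean D : 'rV[R]_d :=
  \row_(i < d) fine ('E_D[fun x : 'rV[R]_d => x ord0 i])%E.

Definition weak_moment (alpha : R) D : Prop :=
  has_mean D /\
  forall v : 'rV[R]_d, enorm v = 1 ->
    ('E_D[fun x : 'rV[R]_d => (`|dotr v (x - mean D)| `^ (1 + alpha))%R] <= 1)%E.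

End moments.

(* Main.v *)
(* Hypercube lower bound. Let b have i.i.d. Bernoulli(q) coordinates indexed by
   S, and for a sign vector v let D_v be the law of the vector with entries
   a * v_i * b_i for i in S and 0 elsewhere. If coordinate i is 0 in all n
   samples, the data carry no information about v_i. Flipping v on the unseen
   coordinates U moves the mean by 2aq in each of them, so, averaging over v,
   every estimator errs by at least a * q * sqrt m with probability at least
   P(#|U| >= m) / 2, where each coordinate is unseen with probability
   (1 - q)^n. The three terms of the maximum come from three choices:
   - (log(2/delta)/n)^(alpha/(1+alpha)): one coordinate, (1 - q)^n = 2 delta;
   - (d/n)^(alpha/(1+alpha)) when d <= n: all coordinates, q = 1/(4n), and a
     saturating the sparse bound E|<u, X - mu>|^(1+alpha) <= 2 lam^(1+alpha) q d
     with a = lam * sqrt d;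
   - sqrt(d/n) when d > n: all coordinates, q = 1/(4n), a = 1/sqrt q, so that
     the covariance is at most the identity.
   Only the largest term matters, so the family may depend on which it is. *)
Require Import Defs.
From HB Require Import structures.
From mathcomp Require Import all_boot all_order all_algebra.
From mathcomp Require Import all_classical all_reals all_analysis.
From mathcomp Require Import measurable_realfun ring lra.

Set Implicit Arguments.
Unset Strict Implicit.
Unset Printing Implicit Defensive.

Import Order.TTheory GRing.Theory Num.Theory.
Import numFieldNormedType.Exports.

Local Open Scope classical_set_scope.
Local Open Scope ring_scope.

(** * Finitely supported probability laws and their integrals *)

Section finite_law.
Context (dT : measure_display) (T : measurableType dT) (R : realType).
Context (O : finType) (w : O -> R) (x : O -> T).
Hypotheses (w_ge0 : forall o, 0 <= w o) (w_sum1 : \sum_o w o = 1).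

(** [msum] takes a sequence of measures, so the outcomes are enumerated; [mzero] is a default value
    for indices past the summed range. *)
Let atom (k : nat) : {measure set T -> \bar R} :=
  if insub k is Some i then
    mscale (NngNum (w_ge0 (enum_val (i : 'I_#|O|)))) \d_(x (enum_val i))
  else mzero.

(** The proof of normalisation is an argument so that the probability instance declared below can be
    inferred from the term itself. *)
Definition finlaw of (\sum_o w o = 1) : set T -> \bar R := msum atom #|O|.

Let P := finlaw w_sum1.

HB.instance Definition _ := Measure.on P.

Lemma finlaw_integral_ge0 (f : T -> \bar R) :
  measurable_fun setT f -> (forall y, 0 <= f y)%E ->
  (\int[P]_y f y = \sum_o (w o)%:E * f (x o))%E.
Proof.
move=> mf f0; rewrite ge0_integral_measure_sum//.
rewrite (reindex (@enum_val O O)); last exact/onW_bij/enum_val_bij.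
apply: eq_bigr => i _; rewrite /atom; case: insubP => [j _ ji|]; last by rewrite ltn_ord.
rewrite (val_inj ji : j = i) ge0_integral_mscale//= integral_dirac//.
by rewrite diracT mul1e.
Qed.

Let finlaw_setT : P [set: T] = 1%E.
Proof.
rewrite -[LHS]mul1e -integral_cst// finlaw_integral_ge0//.
by under eq_bigr do rewrite mule1; rewrite sumEFin w_sum1.
Qed.

HB.instance Definition _ := Measure_isProbability.Build _ _ _ P finlaw_setT.

Lemma finlaw_integrable (f : T -> R) :
  measurable_fun setT f -> P.-integrable [set: T] (EFin \o f).
Proof.
move=> mf; have mfE : measurable_fun setT (EFin \o f) by exact/measurable_EFinP.
apply/integrableP; split => //.
rewrite finlaw_integral_ge0//; last exact: measurableT_comp.
by under eq_bigr do rewrite /= -EFinM; rewrite sumEFin ltry.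
Qed.

(** The formula for nonnegative functions is applied to the positive and the negative part of
    [f]. *)
Lemma finlaw_expectation (f : T -> R) : measurable_fun setT f ->
  ('E_P[f] = (\sum_o w o * f (x o))%R%:E)%E.
Proof.
move=> mf; have mfE : measurable_fun setT (EFin \o f) by exact/measurable_EFinP.
have fE (g : T -> R) : measurable_fun setT g -> (forall y, 0 <= g y) ->
    (\int[P]_y (g y)%:E = (\sum_o w o * g (x o))%R%:E)%E.
  move=> mg g0; rewrite finlaw_integral_ge0//=; last exact/measurable_EFinP.
  by rewrite -sumEFin; apply: eq_bigr => o _; rewrite EFinM.
rewrite unlock integralE.
rewrite [X in (X - _)%E](_ : _ = \int[P]_y (Num.max (f y) 0)%:E)%E; last first.
  by apply: eq_integral => y _; rewrite funeposE EFin_max.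
rewrite [X in (_ - X)%E](_ : _ = \int[P]_y (Num.max (- f y) 0)%:E)%E; last first.
  by apply: eq_integral => y _; rewrite funenegE EFin_max.
rewrite !fE.
- rewrite -EFinB -sumrB; congr EFin; apply: eq_bigr => o _.
  rewrite -mulrBr; congr (_ * _).
  by case: (leP (f (x o)) 0); case: (leP (- f (x o)) 0); lra.
- by apply: measurable_maxr => //; exact: measurableT_comp.
- by move=> y; rewrite le_max lexx orbT.
- exact: measurable_maxr.
- by move=> y; rewrite le_max lexx orbT.
Qed.

End finite_law.

(** * Independent samples from a finitely supported law *)

Lemma sum_tupleS (V : nmodType) (O : finType) (n : nat) (F : n.+1.-tuple O -> V) :
  \sum_t F t = \sum_o \sum_(t : n.-tuple O) F [tuple of o :: t].
Proof.
rewrite (reindex (fun p : O * n.-tuple O => [tuple of p.1 :: p.2])); last first.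
  apply/onW_bij; exists (fun t => (thead t, [tuple of behead t])).
    by case=> o t; congr pair; exact/val_inj.
  by move=> t; rewrite -tuple_eta.
by rewrite pair_big.
Qed.

Section iid_finite_law.
Context (dT : measure_display) (T : measurableType dT) (R : realType).
Context (O : finType) (w : O -> R) (x : O -> T).
Hypotheses (w_ge0 : forall o, 0 <= w o) (w_sum1 : \sum_o w o = 1).

(** Induction on the sample size: the product measure of [A] integrates, over the first draw, the
    measures of the sections of [A], and this integral is a finite sum. *)
Lemma iid_finlaw (n : nat) (A : set (n.-tuple T)) : measurable A ->
  iid (finlaw x w_ge0 w_sum1) n A =
    (\sum_(t : n.-tuple O) (\prod_(o <- t) w o) * \1_A [tuple of map x t])%R%:E.
Proof.
elim: n A => [|n IH] A mA.
  rewrite (big_pred1 [tuple]); last by move=> t; apply/esym/eqP; rewrite [t]tuple0.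
  rewrite /= big_nil mul1r diracE indicE; do 2 f_equal.
  by congr (nat_of_bool (_ \in A)); exact: val_inj.
have mtA : measurable (@tcons _ T n @^-1` A).
  by rewrite -[X in measurable X]setTI; exact: measurable_tcons.
rewrite /= /distribution /pushforward /product_measure1.
rewrite finlaw_integral_ge0//; last exact: measurable_fun_xsection.
rewrite sum_tupleS -sumEFin; apply: eq_bigr => o _ /=.
rewrite IH; last exact: measurable_xsection.
rewrite -EFinM mulr_sumr; congr EFin; apply: eq_bigr => t _.
rewrite big_cons mulrA; congr (_ * _); rewrite !indicE; congr (_ : bool)%:R.
apply/idP/idP; rewrite !inE /xsection/= ?inE/= => H.
  by rewrite [X in A X](_ : _ = tcons (x o, [tuple of map x t])); last exact/val_inj.
by rewrite [X in A X](_ : _ = [tuple of map x [tuple of o :: t]]); last exact/val_inj.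
Qed.

End iid_finite_law.

(** * Borel measurability of coordinates, inner products and norms *)

Section borel_row.
Context (R : realType) (d : nat).
Implicit Types (u m : 'rV[R]_d).

Lemma measurable_coord (i : 'I_d) :
  measurable_fun setT (fun y : 'rV[R]_d => y ord0 i).
Proof.
apply: (measurability _ (RGenOpens.measurableE R)).
move=> _ [_ [a [b ->] <-]]; rewrite setTI; apply: sub_gen_smallest.
have /continuousP := @coord_continuous R 1 d ord0 i; apply; exact: interval_open.
Qed.

Lemma measurable_coordB m (i : 'I_d) :
  measurable_fun setT (fun y : 'rV[R]_d => (y - m) ord0 i).
Proof.
under eq_fun do rewrite !mxE.
by apply: measurable_funB; [exact: measurable_coord|exact: measurable_cst].
Qed.

Lemma measurable_dotrB u m :
  measurable_fun setT (fun y : 'rV[R]_d => dotr u (y - m)).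
Proof.
apply: measurable_sum => i.
by apply: measurable_funM; [exact: measurable_cst|exact: measurable_coordB].
Qed.

Lemma measurable_enormB m :
  measurable_fun setT (fun y : 'rV[R]_d => enorm (y - m)).
Proof.
apply: (measurableT_comp (continuous_measurable_fun (@sqrt_continuous R))).
by apply: measurable_sum => i; apply: measurable_funM; exact: measurable_coordB.
Qed.

End borel_row.

(** * Moments of linear forms in centered Bernoulli variables *)

Lemma powR_le_quadratic (R : realType) (s t : R) : 0 < s <= 2 -> 0 <= t ->
  t `^ s <= s / 2 * t ^+ 2 + (1 - s / 2).
Proof.
move=> /andP[s0]; rewrite le_eqVlt => /predU1P[->|s2] t0.
  by rewrite powR_mulrn// divff ?pnatr_eq0// mul1r subrr addr0.
(* Young's inequality for the product of the power and 1, with conjugate exponents [2 / s] and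
   [2 / (2 - s)]; the second one degenerates at [s = 2], which was treated separately. *)
have s20 : 0 < 2 - s by rewrite subr_gt0.
have /(conjugate_powR (powR_ge0 t s) ler01) : 0 < 2 / s by exact: divr_gt0.
move=> /(_ (2 / (2 - s))); rewrite mulr1 powR1 -powRrM.
have -> : s * (2 / s) = 2%:R by field; rewrite gt_eqF.
rewrite powR_mulrn// !invf_div mul1r => H; apply: le_trans (H _ _) _.
- exact: divr_gt0.
- by field.
- by rewrite le_eqVlt; apply/orP; left; apply/eqP; field.
Qed.

Section bernoulli_cube.
Context (R : realType) (d : nat) (q : R).
Hypothesis q01 : 0 <= q <= 1.
Implicit Types (b : {ffun 'I_d -> bool}) (S : {set 'I_d}).

Let q_ge0 : 0 <= q. Proof. by case/andP: q01. Qed.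
Let q_le1 : q <= 1. Proof. by case/andP: q01. Qed.

Definition cube_weight b : R := \prod_i (if b i then q else 1 - q).

Lemma cube_weight_ge0 b : 0 <= cube_weight b.
Proof. by apply: prodr_ge0 => i _; case: ifP => _; rewrite ?subr_ge0. Qed.

(** Independence of the coordinates: the expectation of a product factorises, by distributivity of
    products over sums. *)
Lemma cube_sum_prod (F : 'I_d -> bool -> R) :
  \sum_b cube_weight b * \prod_i F i (b i) =
  \prod_i (q * F i true + (1 - q) * F i false).
Proof.
transitivity (\prod_i \sum_(c : bool) (if c then q else 1 - q) * F i c).
  by rewrite bigA_distr_bigA; apply: eq_bigr => b _; rewrite -big_split.
by apply: eq_bigr => i _; rewrite big_bool.
Qed.

Lemma cube_weight_sum1 : \sum_b cube_weight b = 1.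
Proof.
transitivity (\sum_b cube_weight b * \prod_(i < d) (1 : R)).
  by apply: eq_bigr => b _; rewrite big1_eq mulr1.
by rewrite (cube_sum_prod (fun _ _ => 1)) big1// => i _; ring.
Qed.

Lemma cube_sum_coord (f : bool -> R) i :
  \sum_b cube_weight b * f (b i) = q * f true + (1 - q) * f false.
Proof.
transitivity (\sum_b cube_weight b * \prod_j (if j == i then f (b j) else 1)).
  by apply: eq_bigr => b _; rewrite -big_mkcond big_pred1_eq.
rewrite (cube_sum_prod (fun j c => if j == i then f c else 1)) (bigD1 i)//= eqxx.
rewrite big1 ?mulr1// => j /negPf ->; ring.
Qed.

Lemma cube_covariance i j :
  \sum_b cube_weight b * (((b i)%:R - q) * ((b j)%:R - q)) =
  (q * (1 - q)) *+ (i == j).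
Proof.
(* Writing both factors as one product over all coordinates covers the diagonal and the off-diagonal
   case by the same factorisation. *)
pose F k (c : bool) : R :=
  (if k == i then c%:R - q else 1) * (if k == j then c%:R - q else 1).
transitivity (\sum_b cube_weight b * \prod_k F k (b k)).
  by apply: eq_bigr => b _; rewrite big_split/= -!big_mkcond !big_pred1_eq.
rewrite cube_sum_prod (bigD1 i)//= /F eqxx; have [->|ij] := eqVneq i j.
  rewrite big1 => [|k /negPf ->]; last by rewrite mulr1; ring.
  by rewrite /= mulr1n mulr0n; ring.
by rewrite [X in X * _](_ : _ = 0) ?mul0r//= mulr0n; ring.
Qed.

Lemma cube_variance (c : 'I_d -> R) :
  \sum_b cube_weight b * (\sum_i c i * ((b i)%:R - q)) ^+ 2 =
  q * (1 - q) * \sum_i c i ^+ 2.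
Proof.
transitivity (\sum_i \sum_j c i * c j *
    \sum_b cube_weight b * (((b i)%:R - q) * ((b j)%:R - q))).
  under eq_bigr => b _.
    rewrite expr2 mulr_suml mulr_sumr.
    under eq_bigr do rewrite 2!mulr_sumr.
    over.
  rewrite exchange_big; apply: eq_bigr => i _.
  rewrite exchange_big; apply: eq_bigr => j _.
  by rewrite mulr_sumr; apply: eq_bigr => b _; ring.
rewrite mulr_sumr; apply: eq_bigr => i _.
rewrite (bigD1 i)//= cube_covariance eqxx mulr1n big1 => [|j ji]; first by ring.
by rewrite cube_covariance eq_sym (negPf ji) mulr0.
Qed.

(** Union bound: the indicator is at most the number of coordinates of [S] where [b] is true. *)
Lemma cube_weight_meets S :
  \sum_b cube_weight b * [exists i in S, b i]%:R <= q * #|S|%:R.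
Proof.
have -> : q * #|S|%:R = \sum_(i in S) \sum_b cube_weight b * (b i)%:R.
  under eq_bigr do rewrite (cube_sum_coord (fun c => c%:R)) mulr1 mulr0 addr0.
  by rewrite sumr_const mulr_natr.
rewrite exchange_big; apply: ler_sum => b _; rewrite -mulr_sumr.
apply: ler_wpM2l; first exact: cube_weight_ge0.
case: exists_inP => [[i iS bi]|_]; last by apply: sumr_ge0 => i _; exact: ler0n.
by rewrite (bigD1 i)//= bi lerDl; apply: sumr_ge0 => j _; exact: ler0n.
Qed.

(** Cauchy-Schwarz, obtained by expanding the nonnegative sum of squared deviations from the average
    over [S]. *)
Lemma sqr_sum_le_card S (c : 'I_d -> R) :
  (\sum_(i in S) c i) ^+ 2 <= #|S|%:R * \sum_(i in S) c i ^+ 2.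
Proof.
have [->|[i0 i0S]] := set_0Vmem S; first by rewrite !big_set0 expr0n mulr0.
have k0 : 0 < #|S|%:R :> R by rewrite ltr0n; apply/card_gt0P; exists i0.
set t := \sum_(i in S) c i.
have : 0 <= \sum_(i in S) (c i - t / #|S|%:R) ^+ 2.
  by apply: sumr_ge0 => i _; exact: sqr_ge0.
rewrite (_ : \sum_(i in S) _ = \sum_(i in S) c i ^+ 2 - t ^+ 2 / #|S|%:R).
  by rewrite subr_ge0 ler_pdivrMr// mulrC.
transitivity (\sum_(i in S) c i ^+ 2 - 2 * (t / #|S|%:R) * \sum_(i in S) c i
    + #|S|%:R * (t / #|S|%:R) ^+ 2).
  move: (t / _) => u.
  rewrite mulr_sumr (mulr_natl _ #|S|) -sumr_const -sumrB -big_split.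
  by apply: eq_bigr => i _ /=; ring.
by rewrite -/t; field; rewrite gt_eqF.
Qed.

(* Off the event that [b] meets [S], the centered sum is the constant
   [- q * \sum_i c i]; on that event, which has probability at most [q * #|S|],
   the power is dominated by a quadratic polynomial at scale [lam]. *)
Lemma cube_moment_le S (c : 'I_d -> R) (s lam : R) : 1 <= s <= 2 -> 0 < lam ->
  (forall i, i \notin S -> c i = 0) -> q * #|S|%:R <= 1 ->
  \sum_i c i ^+ 2 <= lam ^+ 2 * #|S|%:R ->
  \sum_b cube_weight b * `|\sum_i c i * ((b i)%:R - q)| `^ s <=
  2 * lam `^ s * (q * #|S|%:R).
Proof.
move=> /andP[s1 s2] lam0 cS qk1 c2.
have s0 : 0 < s by apply: lt_le_trans s1.
set p := q * #|S|%:R.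
have p0 : 0 <= p by apply: mulr_ge0 => //; exact: ler0n.
have cSE : \sum_i c i ^+ 2 = \sum_(i in S) c i ^+ 2.
  rewrite [RHS]big_mkcond; apply: eq_bigr => i _.
  by case: ifPn => // /cS ->; rewrite expr0n.
have scale (t : R) : 0 <= t ->
    t `^ s <= lam `^ s * (s / 2 * (t / lam) ^+ 2 + (1 - s / 2)).
  move=> t0; rewrite -[t in leLHS](divfK (lt0r_neq0 lam0)) mulrC.
  rewrite powRM ?(ltW lam0)//; last by rewrite divr_ge0// ltW.
  apply: ler_wpM2l; first exact: powR_ge0.
  by apply: powR_le_quadratic; rewrite ?s0 ?s2// divr_ge0// ltW.
(* The constant [1 - s / 2] of the quadratic bound is charged only when [b] meets [S]; the summand
   [p] pays for the other event. *)
have pt b : `|\sum_i c i * ((b i)%:R - q)| `^ s <=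
    lam `^ s * (p + s / 2 * ((\sum_i c i * ((b i)%:R - q)) ^+ 2 / lam ^+ 2)
      + (1 - s / 2) * [exists i in S, b i]%:R).
  set z := \sum_i _; case: exists_inP => [_|bS].
    apply: le_trans (scale _ (normr_ge0 _)) _.
    rewrite ler_wpM2l ?powR_ge0// expr_div_n real_normK ?num_real// mulr1.
    by rewrite -addrA lerDr.
  rewrite mulr0 addr0 mulrDr; apply: (@le_trans _ _ (lam `^ s * p)); last first.
    rewrite lerDl mulr_ge0 ?powR_ge0// mulr_ge0 ?divr_ge0 ?sqr_ge0//; exact: ltW.
  have zE : `|z| = q * `|\sum_(i in S) c i|.
    rewrite -[q in RHS]ger0_norm// -normrM -normrN mulr_sumr -sumrN.
    congr (`|_|); rewrite [RHS]big_mkcond; apply: eq_bigr => i _.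
    case: ifPn => [iS|/cS ->]; last by rewrite mul0r oppr0.
    by have [bi|_] := boolP (b i); [case: bS; exists i|rewrite mulr0n; ring].
  (* Cauchy-Schwarz on [S] bounds the constant; since [p <= 1 <= s], the power of [p] arising next
     is at most [p]. *)
  have zle : `|z| <= lam * p.
    rewrite -ler_sqr ?nnegrE ?mulr_ge0//; last exact: ltW.
    rewrite zE exprMn real_normK ?num_real//.
    apply: (@le_trans _ _ (q ^+ 2 * (#|S|%:R * (lam ^+ 2 * #|S|%:R)))).
      rewrite ler_wpM2l ?sqr_ge0//; apply: le_trans (sqr_sum_le_card _ _) _.
      by rewrite ler_wpM2l// -cSE.
    by rewrite le_eqVlt; apply/orP; left; apply/eqP; rewrite /p; ring.
  apply: (@le_trans _ _ ((lam * p) `^ s)).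
    by apply: ge0_ler_powR; rewrite ?nnegrE ?mulr_ge0 ?(ltW s0) ?(ltW lam0).
  rewrite powRM ?(ltW lam0)// ler_wpM2l ?powR_ge0//.
  have [->|pn0] := eqVneq p 0; first by rewrite powR0// gt_eqF.
  by apply: ge1r_powR => //; rewrite lt_neqAle eq_sym pn0 p0.
apply: (@le_trans _ _ (\sum_b cube_weight b * (lam `^ s * (p + s / 2 *
    ((\sum_i c i * ((b i)%:R - q)) ^+ 2 / lam ^+ 2)
      + (1 - s / 2) * [exists i in S, b i]%:R)))).
  by apply: ler_sum => b _; rewrite ler_wpM2l ?cube_weight_ge0.
rewrite (_ : \sum_b _ = lam `^ s * (p * \sum_b cube_weight b
   + s / 2 / lam ^+ 2 * \sum_b cube_weight b * (\sum_i c i * ((b i)%:R - q)) ^+ 2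
   + (1 - s / 2) * \sum_b cube_weight b * [exists i in S, b i]%:R)); last first.
  rewrite !mulr_sumr -!big_split mulr_sumr /=; apply: eq_bigr => b _.
  by field; rewrite gt_eqF.
rewrite cube_weight_sum1 cube_variance mulr1.
rewrite (_ : 2 * lam `^ s * p = lam `^ s * (2 * p)); last by ring.
apply: ler_wpM2l; first exact: powR_ge0.
(* The three terms are at most [p], [s / 2 * p] and [(1 - s / 2) * p], which add up to [2 * p]. *)
have v1 : s / 2 / lam ^+ 2 * (q * (1 - q) * \sum_i c i ^+ 2) <= s / 2 * p.
  rewrite -mulrA ler_wpM2l ?divr_ge0 ?(ltW s0)// mulrC ler_pdivrMr ?exprn_gt0//.
  apply: (@le_trans _ _ (q * \sum_i c i ^+ 2)).
    apply: ler_wpM2r; first by apply: sumr_ge0 => i _; exact: sqr_ge0.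
    by rewrite ler_piMr// gerBl.
  by rewrite /p -mulrA (mulrC #|S|%:R) ler_wpM2l.
have v2 : (1 - s / 2) * \sum_b cube_weight b * [exists i in S, b i]%:R <=
    (1 - s / 2) * p.
  by rewrite ler_wpM2l ?cube_weight_meets// subr_ge0 ler_pdivrMr// mul1r.
by lra.
Qed.

(** The quadratic bound at scale 1 reduces the moment to the variance, and
    [s / 2 + (1 - s / 2) = 1]. *)
Lemma cube_moment_le1 (c : 'I_d -> R) (s : R) : 1 <= s <= 2 ->
  q * \sum_i c i ^+ 2 <= 1 ->
  \sum_b cube_weight b * `|\sum_i c i * ((b i)%:R - q)| `^ s <= 1.
Proof.
move=> /andP[s1 s2] c1; have s0 : 0 < s by apply: lt_le_trans s1.
apply: (@le_trans _ _ (\sum_b cube_weight b *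
    (s / 2 * (\sum_i c i * ((b i)%:R - q)) ^+ 2 + (1 - s / 2)))).
  apply: ler_sum => b _; rewrite ler_wpM2l ?cube_weight_ge0//.
  by rewrite -[(\sum_i _) ^+ 2]real_normK ?num_real// powR_le_quadratic ?s0.
rewrite (_ : \sum_b _ = s / 2 *
    (\sum_b cube_weight b * (\sum_i c i * ((b i)%:R - q)) ^+ 2)
   + (1 - s / 2) * \sum_b cube_weight b); last first.
  rewrite !mulr_sumr -big_split/=; apply: eq_bigr => b _; ring.
rewrite cube_weight_sum1 cube_variance mulr1.
have : q * (1 - q) * \sum_i c i ^+ 2 <= 1.
  apply: le_trans c1; apply: ler_wpM2r; first by apply: sumr_ge0 => i _; exact: sqr_ge0.
  by rewrite ler_piMr// gerBl.
by move=> /(ler_wpM2l (divr_ge0 (ltW s0) (ler0n R 2))); lra.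
Qed.

End bernoulli_cube.

(** * Coordinates that vanish in the whole sample *)

Lemma sum_tuple_prod (R : comPzRingType) (O : finType) (n : nat) (g : O -> R) :
  \sum_(t : n.-tuple O) \prod_(o <- t) g o = (\sum_o g o) ^+ n.
Proof.
elim: n => [|n IH].
  rewrite (big_pred1 [tuple]) ?big_nil//; last first.
    by move=> t; apply/esym/eqP; rewrite [t]tuple0.
rewrite sum_tupleS exprS mulr_suml; apply: eq_bigr => o _.
by rewrite -IH mulr_sumr; apply: eq_bigr => t _; rewrite big_cons.
Qed.

Section unseen_coordinates.
Context (R : realType) (d : nat) (q : R).
Hypothesis q01 : 0 <= q <= 1.
Let cube := {ffun 'I_d -> bool}.

Definition sample_weight (t : seq cube) : R := \prod_(b <- t) cube_weight q b.

Definition unseen (t : seq cube) : {set 'I_d} :=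
  [set i | all (fun b : cube => ~~ b i) t].

Lemma sample_weight_ge0 t : 0 <= sample_weight t.
Proof. by apply: prodr_ge0 => b _; exact: cube_weight_ge0. Qed.

Lemma sample_weight_sum1 n : \sum_(t : n.-tuple cube) sample_weight t = 1.
Proof. by rewrite sum_tuple_prod cube_weight_sum1 expr1n. Qed.

Lemma sample_weight_unseen n (i : 'I_d) :
  \sum_(t : n.-tuple cube) sample_weight t * (i \in unseen t)%:R = (1 - q) ^+ n.
Proof.
rewrite -[1 - q](_ : \sum_b cube_weight q b * (~~ b i)%:R = _); last first.
  by rewrite (cube_sum_coord _ (fun c => (~~ c)%:R))/= mulr0 add0r mulr1.
rewrite -sum_tuple_prod; apply: eq_bigr => t _.
rewrite big_split/= inE; congr (_ * _).
elim: (tval t) => [|b s IH] /=; first by rewrite big_nil.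
by rewrite big_cons -IH -natrM mulnb.
Qed.

Lemma sample_weight_card_unseen n (S : {set 'I_d}) :
  \sum_(t : n.-tuple cube) sample_weight t * #|unseen t :&: S|%:R =
  #|S|%:R * (1 - q) ^+ n.
Proof.
rewrite mulr_natl -sumr_const.
under [RHS]eq_bigr => i _ do rewrite -(sample_weight_unseen n i).
rewrite exchange_big; apply: eq_bigr => t _; rewrite -mulr_sumr; congr (_ * _).
rewrite -natr_sum -sum1_card big_mkcond [in RHS]big_mkcond.
congr (_%:R); apply: eq_bigr => i _; rewrite !inE.
by rewrite andbC; case: (i \in S) => //=; case: all.
Qed.

(** Reverse Markov inequality: the count never exceeds [#|S|] and has mean at least [3 / 4 * #|S|];
    splitting at [#|S| / 2] leaves probability at least one half for the upper part. *)
Lemma half_unseen_prob n (S : {set 'I_d}) : (0 < #|S|)%N ->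
  3 / 4 <= (1 - q) ^+ n ->
  1 / 2 <= \sum_(t : n.-tuple cube)
    sample_weight t * (#|S|%:R / 2 <= #|unseen t :&: S|%:R :> R)%:R.
Proof.
move=> S0 q34; have k0 : 0 < #|S|%:R :> R by rewrite ltr0n.
set P := \sum_t _.
have : #|S|%:R * (3 / 4) <= #|S|%:R / 2 + #|S|%:R / 2 * P.
  apply: (@le_trans _ _ (\sum_(t : n.-tuple cube)
      sample_weight t * #|unseen t :&: S|%:R)).
    by rewrite sample_weight_card_unseen ler_wpM2l// ltW.
  rewrite -{1}[#|S|%:R / 2]mulr1 -[X in _ * X + _](sample_weight_sum1 n) /P.
  rewrite !mulr_sumr -big_split.
  apply: ler_sum => t _ /=.
  rewrite (mulrCA _ (sample_weight t)) (mulrC _ (sample_weight t)) -mulrDr.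
  apply: ler_wpM2l; first exact: sample_weight_ge0.
  have [_|/ltW] := lerP (#|S|%:R / 2) (#|unseen t :&: S|%:R : R).
    rewrite mulr1 -splitr ler_nat; exact/subset_leq_card/finset.subsetIr.
  by rewrite mulr0 addr0.
rewrite -[X in X + _]mulr1 -mulrDr -mulrA ler_pM2l//.
lra.
Qed.

End unseen_coordinates.

(** * Signed cube laws and the flipping argument *)

Section cube_law.
Context (R : realType) (d : nat) (q a : R) (S : {set 'I_d}).
Hypotheses (q01 : 0 <= q <= 1) (a_ge0 : 0 <= a).
Let cube := {ffun 'I_d -> bool}.
Implicit Types (v b : cube).

Definition amplitude v (i : 'I_d) : R := if i \in S then a * (-1) ^+ v i else 0.

Definition cube_point v b : 'rV[R]_d := \row_i (amplitude v i * (b i)%:R).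

Definition cube_law v : probability 'rV[R]_d R :=
  finlaw (cube_point v) (cube_weight_ge0 q01) (cube_weight_sum1 d q).

Lemma amplitude_sqr v i : amplitude v i ^+ 2 = a ^+ 2 *+ (i \in S).
Proof.
rewrite /amplitude; case: ifP => _; last by rewrite expr0n.
by rewrite exprMn sqrr_sign mulr1.
Qed.

Lemma mean_cube_law v : mean (cube_law v) = \row_i (q * amplitude v i).
Proof.
apply/rowP => i; rewrite !mxE finlaw_expectation/=; last exact: measurable_coord.
under eq_bigr do rewrite mxE mulrCA.
rewrite -mulr_sumr (cube_sum_coord q (fun c => c%:R)).
by rewrite mulr1 mulr0 addr0 mulrC.
Qed.

(** Projecting on a unit vector [u] gives a linear form with coefficients
    [u ord0 i * amplitude v i], whose squares sum to at most [a ^+ 2]. *)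
Lemma weak_moment_cube_law alpha v :
  (forall c : 'I_d -> R, (forall i, i \notin S -> c i = 0) ->
    \sum_i c i ^+ 2 <= a ^+ 2 ->
    \sum_b cube_weight q b * `|\sum_i c i * ((b i)%:R - q)| `^ (1 + alpha) <= 1) ->
  weak_moment alpha (cube_law v).
Proof.
move=> H; split=> [i|u u1].
  by apply: finlaw_integrable; exact: measurable_coord.
rewrite finlaw_expectation; last first.
  apply: (measurableT_comp (@measurable_powR R (1 + alpha))).
  by apply: measurableT_comp => //; exact: measurable_dotrB.
rewrite lee_fin mean_cube_law.
rewrite (eq_bigr (fun b => cube_weight q b *
    `|\sum_i u ord0 i * amplitude v i * ((b i)%:R - q)| `^ (1 + alpha))); last first.
  move=> b _; congr (_ * (`|_| `^ _)); apply: eq_bigr => i _.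
  by rewrite !mxE; ring.
apply: H => [i iS|]; first by rewrite /amplitude (negPf iS) mulr0.
apply: (@le_trans _ _ (a ^+ 2 * \sum_i u ord0 i ^+ 2)).
  rewrite mulr_sumr; apply: ler_sum => i _; rewrite exprMn amplitude_sqr mulrC.
  by rewrite ler_wpM2r ?sqr_ge0//; case: (i \in S); rewrite ?lexx ?sqr_ge0.
rewrite -[leRHS]mulr1 ler_wpM2l ?sqr_ge0//.
have -> : \sum_i u ord0 i ^+ 2 = enorm u ^+ 2.
  by rewrite sqr_sqrtr// sumr_ge0// => i _; exact: sqr_ge0.
by rewrite u1 expr1n.
Qed.

Definition flip (t : seq cube) v : cube := [ffun i => v i (+) (i \in unseen t)].

Lemma flipK t : involutive (flip t).
Proof. by move=> v; apply/ffunP => i; rewrite !ffunE addbK. Qed.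

(** Where the sign changes, every [b] in the sample is false, so the sign is multiplied by zero. *)
Lemma map_cube_point_flip t v :
  map (cube_point (flip t v)) t = map (cube_point v) t.
Proof.
apply/eq_in_map => b bt; apply/rowP => i; rewrite !mxE /amplitude ffunE inE.
have [/allP/(_ _ bt)/negPf ->|_] := boolP (all _ t); first by rewrite !mulr0.
by rewrite addbF.
Qed.

(* Parallelogram identity on the flipped coordinates. *)
Lemma flip_separation t v (m : R) (y : 'rV[R]_d) :
  0 <= m -> m <= #|unseen t :&: S|%:R ->
  (a * q * Num.sqrt m <= enorm (y - mean (cube_law v))) ||
  (a * q * Num.sqrt m <= enorm (y - mean (cube_law (flip t v)))).
Proof.
move=> m0 mU; have [/andP[q0 _]] := q01.
apply: contraT; rewrite negb_or -!ltNge => /andP[lt1 lt2].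
have sq (z : 'rV[R]_d) : enorm z < a * q * Num.sqrt m -> dotr z z < (a * q) ^+ 2 * m.
  move=> zm; have zz : 0 <= dotr z z by apply: sumr_ge0 => i _; exact: sqr_ge0.
  rewrite -(sqr_sqrtr zz) -[X in _ * X](sqr_sqrtr m0) -exprMn.
  by rewrite ltr_sqr// nnegrE ?mulr_ge0 ?sqrtr_ge0.
have := ltrD (sq _ lt1) (sq _ lt2); rewrite ltNge => /negP; case.
apply: (@le_trans _ _ (\sum_(i in unseen t :&: S) ((a * q) ^+ 2 *+ 2))).
  rewrite sumr_const -mulr2n mulrnAC lerMn2r/= -[leRHS]mulr_natr.
  by apply: ler_wpM2l; first exact: sqr_ge0.
rewrite /dotr -big_split big_mkcond !mean_cube_law; apply: ler_sum => i _ /=.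
case: ifPn => [|_]; last by rewrite addr_ge0 ?sqr_ge0.
rewrite inE !mxE /amplitude ffunE => /andP[-> ->]; rewrite addbT signrN.
have /eqP := sqrr_sign R (v i); set e := (-1) ^+ _ => /eqP e2.
have y0 : 0 <= y ord0 i ^+ 2 by exact: sqr_ge0.
rewrite [leRHS](_ : _ = y ord0 i ^+ 2 *+ 2 + (a * q) ^+ 2 * (e ^+ 2) *+ 2); last by ring.
by rewrite e2 mulr1 lerDr mulrn_wge0.
Qed.

(* Averaging over [v]: the sample does not change when [v] is flipped on the
   unseen coordinates, so for each good sample at least half of the [v] are bad. *)
Lemma cube_law_minimax n (m r delta : R) : 0 <= m -> r <= a * q * Num.sqrt m ->
  2 * delta <= \sum_(t : n.-tuple cube)
    sample_weight q t * (m <= #|unseen t :&: S|%:R :> R)%:R ->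
  forall muhat : {mfun n.-tuple 'rV[R]_d >-> 'rV[R]_d}, exists v,
    (delta%:E <= iid (cube_law v) n
      [set X | (r <= enorm (muhat X - mean (cube_law v)))%R])%E.
Proof.
move=> m0 rm hdelta muhat.
pose err v (t : n.-tuple cube) :=
  r <= enorm (muhat [tuple of map (cube_point v) t] - mean (cube_law v)).
pose p v := \sum_(t : n.-tuple cube) sample_weight q t * (err v t)%:R.
have iidE v : iid (cube_law v) n
    [set X | (r <= enorm (muhat X - mean (cube_law v)))%R] = (p v)%:E.
  rewrite iid_finlaw; last first.
    rewrite -[X in measurable X]setTI.
    have mf := measurableT_comp (measurable_enormB (mean (cube_law v)))
      (measurable_funPT muhat).
    have := mf measurableT _ (@measurable_itv _ `[r, +oo[).
    congr (measurable _); apply/seteqP; split => X /=; rewrite in_itv/= andbT//.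
  congr EFin; apply: eq_bigr => t _; rewrite indicE; congr (_ * (_ : bool)%:R).
  by apply/idP/idP; rewrite inE.
suff [v pv] : exists v, delta <= p v by exists v; rewrite iidE lee_fin.
apply/not_existsP => no.
have N0 : 0 < #|cube|%:R :> R.
  by rewrite ltr0n; apply/card_gt0P; exists [ffun=> false].
have : \sum_v p v < \sum_(v : cube) delta.
  apply: ltr_sum; first by apply/hasP; exists [ffun=> false]; rewrite ?mem_index_enum.
  by move=> v _; rewrite ltNge; apply/negP; exact: no.
rewrite sumr_const -mulr_natl ltNge => /negP; apply.
rewrite -(ler_pM2l (ltr0n R 2)) mulrCA.
apply: (@le_trans _ _ (#|cube|%:R * \sum_(t : n.-tuple cube)
    sample_weight q t * (m <= #|unseen t :&: S|%:R :> R)%:R)).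
  by rewrite ler_wpM2l// ltW.
rewrite exchange_big mulr_sumr mulr_sumr; apply: ler_sum => t _ /=.
rewrite -mulr_sumr mulrCA [leRHS]mulrCA ler_wpM2l ?sample_weight_ge0//.
rewrite [leLHS]mulr_natl [leRHS]mulr_natl mulr2n.
(* Of the two copies of the sum over [v], one is reindexed by the involution, pairing [v] with its
   flip; on a good sample each pair contains an error. *)
rewrite [X in _ <= X + _](reindex_inj (inv_inj (flipK t))).
rewrite -big_split -sumr_const; apply: ler_sum => v _ /=.
have [mU|_] := lerP m (#|unseen t :&: S|%:R : R); last by rewrite addr_ge0// ler0n.
rewrite -natrD ler1n addn_gt0 !lt0b /err.
rewrite (_ : [tuple of map (cube_point (flip t v)) t] =
  [tuple of map (cube_point v) t]); last first.
  exact/val_inj/map_cube_point_flip.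
have /orP[le1|le2] := flip_separation v (muhat [tuple of map (cube_point v) t]) m0 mU.
  by rewrite (le_trans rm le1) orbT.
by rewrite (le_trans rm le2).
Qed.

End cube_law.

(** * Choice of parameters and the three rates *)

Lemma scaled_powR_le (R : realType) (c x y b : R) :
  0 < c <= 1 -> 0 <= b <= 1 -> 0 <= x -> c * x <= y -> c * x `^ b <= y `^ b.
Proof.
move=> c01 /andP[b0 b1] x0 cxy; have c0 : 0 <= c by case/andP: c01 => /ltW.
have cx0 : 0 <= c * x by exact: mulr_ge0.
(* As [c] and [b] lie in the unit interval, raising [c] to the power [b] does not decrease it. *)
apply: (@le_trans _ _ ((c * x) `^ b)).
  by rewrite powRM// ler_wpM2r ?powR_ge0// ger1_powR.
by apply: ge0_ler_powR => //; rewrite nnegrE//; exact: le_trans cxy.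
Qed.

Lemma exists_moment_scale (R : realType) (alpha p : R) : 0 <= alpha -> 0 < p ->
  exists lam : R, [/\ 0 < lam, 2 * lam `^ (1 + alpha) * p <= 1 &
    p `^ (alpha / (1 + alpha)) / 2 <= lam * p].
Proof.
move=> a0 p0; set s := 1 + alpha; have s0 : 0 < s by rewrite ltr_pwDl.
(* This value makes the moment bound an equality; the leftover factor, 2 to the power [- s^-1], is
   at least one half because [s >= 1]. *)
exists ((2 * p) `^ (- s^-1)); split.
- by rewrite powR_gt0// mulr_gt0.
- rewrite -powRrM mulNr mulVf ?gt_eqF// powR_inv1 ?mulr_ge0 ?(ltW p0)//.
  by rewrite mulrAC divff// mulf_neq0// gt_eqF.
- have pE : p `^ (- s^-1) * p = p `^ (alpha / s).
    rewrite -{2}(powRr1 (ltW p0)) -powRD ?(gt_eqF p0) ?implybT//.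
    by congr (_ `^ _); rewrite /s; field; rewrite gt_eqF.
  rewrite powRM ?(ltW p0)// -mulrA pE.
  rewrite mulrC ler_wpM2r ?powR_ge0//.
  rewrite -[2^-1]powR_inv1// ler_powR ?ler1n// lerN2 invf_le1//.
  by rewrite lerDl.
Qed.

Section minimax.
Context (R : realType) (n d : nat) (alpha delta : R).

(** The threshold is left free so that each regime can supply its own family. *)
Definition minimax_bound (r : R) :=
  exists F : set (probability 'rV[R]_d R),
    (forall D, F D -> weak_moment alpha D) /\
    forall muhat : {mfun n.-tuple 'rV[R]_d >-> 'rV[R]_d},
      exists D, F D /\
        (delta%:E <= iid D n [set X : n.-tuple 'rV[R]_d |
          (r <= enorm (muhat X - mean D))%R])%E.

Lemma cube_minimax_bound (q a m r : R) (S : {set 'I_d}) (q01 : 0 <= q <= 1) :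
  0 <= a -> 0 <= m -> r <= a * q * Num.sqrt m ->
  2 * delta <= \sum_(t : n.-tuple _)
    sample_weight q t * (m <= #|unseen t :&: S|%:R :> R)%:R ->
  (forall c : 'I_d -> R, (forall i, i \notin S -> c i = 0) ->
    \sum_i c i ^+ 2 <= a ^+ 2 ->
    \sum_b cube_weight q b * `|\sum_i c i * ((b i)%:R - q)| `^ (1 + alpha) <= 1) ->
  minimax_bound r.
Proof.
move=> a0 m0 rm dm mom; exists (range (cube_law a S q01)); split.
  by move=> _ [v _ <-]; exact: weak_moment_cube_law.
move=> muhat; have [v vP] := cube_law_minimax q01 a0 m0 rm dm muhat.
by exists (cube_law a S q01 v); split => //; exists v.
Qed.

Lemma sparse_minimax_bound (q m r : R) (S : {set 'I_d}) :
  0 <= alpha <= 1 -> 0 < q -> (0 < #|S|)%N -> q * #|S|%:R <= 1 -> 0 <= m ->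
  r <= (q * #|S|%:R) `^ (alpha / (1 + alpha)) / 2 * Num.sqrt (m / #|S|%:R) ->
  2 * delta <= \sum_(t : n.-tuple _)
    sample_weight q t * (m <= #|unseen t :&: S|%:R :> R)%:R ->
  minimax_bound r.
Proof.
move=> /andP[al0 al1] q0 S0 qk1 m0 rm dm.
have k0 : 0 < #|S|%:R :> R by rewrite ltr0n.
have q01 : 0 <= q <= 1.
  rewrite (ltW q0)/=; apply: le_trans qk1; rewrite ler_peMr ?(ltW q0)//.
  by rewrite ler1n.
have [lam [lam0 mom lamp]] := exists_moment_scale al0 (mulr_gt0 q0 k0).
(* With this amplitude, [a * q * Num.sqrt m] equals [lam * (q * #|S|%:R) * Num.sqrt (m /
   #|S|%:R)]. *)
apply: (@cube_minimax_bound q (lam * Num.sqrt #|S|%:R) m r S q01) => //.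
- by rewrite mulr_ge0 ?sqrtr_ge0// ltW.
- apply: (le_trans rm).
  apply: (@le_trans _ _ (lam * (q * #|S|%:R) * Num.sqrt (m / #|S|%:R))).
    by rewrite ler_wpM2r ?sqrtr_ge0.
  rewrite sqrtrM// sqrtrV ?ler0n// -[X in q * X](sqr_sqrtr (ltW k0)).
  rewrite le_eqVlt; apply/orP; left; apply/eqP; field.
  by rewrite gt_eqF// sqrtr_gt0.
- move=> c cS; rewrite exprMn sqr_sqrtr ?ler0n// => c2.
  apply: le_trans mom; apply: cube_moment_le => //.
  by rewrite lerDl al0/= -lerBrDl (le_trans al1)//; lra.
Qed.

Lemma one_sub_quarter_ge : (0 < n)%N -> 3 / 4 <= (1 - (4 * n%:R)^-1) ^+ n :> R.
Proof.
move=> n0; have nr : 0 < n%:R :> R by rewrite ltr0n.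
set x : R := (4 * n%:R)^-1.
have x0 : 0 <= x by rewrite invr_ge0 mulr_ge0.
have x1 : x <= 1.
  rewrite invf_le1 ?mulr_gt0//.
  by rewrite -[leLHS]mulr1 ler_pM ?ler1n.
(* Bernoulli's inequality; at [k = n] its left side is exactly [3 / 4]. *)
have bern k : 1 - k%:R * x <= (1 - x) ^+ k.
  elim: k => [|k IH]; first by rewrite mul0r subr0.
  rewrite exprS; apply: (@le_trans _ _ ((1 - x) * (1 - k%:R * x))).
    rewrite -natr1 -subr_ge0 [X in 0 <= X](_ : _ = k%:R * x ^+ 2); last by ring.
    by rewrite mulr_ge0 ?sqr_ge0.
  by rewrite ler_wpM2l// subr_ge0.
apply: le_trans (bern n); rewrite /x.
by rewrite le_eqVlt; apply/orP; left; apply/eqP; field; rewrite gt_eqF.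
Qed.

Lemma minimax_bound_dim_small : 0 <= alpha <= 1 -> (0 < d <= n)%N -> delta <= 1 / 4 ->
  minimax_bound (1 / 24 * (d%:R / n%:R) `^ (alpha / (1 + alpha))).
Proof.
move=> al01 /andP[d0 dn] d4; have n0 := leq_trans d0 dn.
have dr : 0 < d%:R :> R by rewrite ltr0n.
have nr : 0 < n%:R :> R by rewrite ltr0n.
have [al0 al1] := andP al01.
have cT : #|[set: 'I_d]%SET| = d by rewrite cardsT card_ord.
have q0 : 0 < (4 * n%:R)^-1 :> R by rewrite invr_gt0 mulr_gt0.
have pE : (4 * n%:R)^-1 * d%:R = 1 / 4 * (d%:R / n%:R) :> R.
  by field; rewrite gt_eqF.
have p1 : 1 / 4 * (d%:R / n%:R) <= 1 :> R.
  have : d%:R / n%:R <= 1 :> R by rewrite ler_pdivrMr// mul1r ler_nat.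
  by lra.
apply: (@sparse_minimax_bound (4 * n%:R)^-1 (d%:R / 2) _ [set: 'I_d]%SET) => //.
- by rewrite cT.
- by rewrite cT pE.
- rewrite cT pE (_ : d%:R / 2 / d%:R = 2^-1); last by field; rewrite gt_eqF.
  set x := d%:R / n%:R; have x0 : 0 <= x by rewrite divr_ge0.
  set b := alpha / (1 + alpha).
  have b01 : 0 <= b <= 1.
    by rewrite /b divr_ge0 ?addr_ge0//= ler_pdivrMr ?mul1r ?lerDr// ltr_pwDl.
  have xb := powR_ge0 x b.
  (* The constants multiply to at least [1 / 4 * (1 / 2) * (1 / 2) = 1 / 16], above [1 / 24]. *)
  have H : 1 / 4 * x `^ b <= (1 / 4 * x) `^ b.
    by apply: scaled_powR_le => //; lra.
  have h2 : 1 / 2 <= Num.sqrt (2^-1) :> R.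
    rewrite -[leLHS]ger0_norm; last by lra.
    rewrite -sqrtr_sqr ler_sqrt; lra.
  by nra.
- have := @half_unseen_prob R d (4 * n%:R)^-1 _ n [set: 'I_d]%SET; rewrite cT.
  move=> H; apply: le_trans (H _ d0 (one_sub_quarter_ge n0)); first by lra.
  rewrite (ltW q0)/= invf_le1 ?mulr_gt0//.
  by rewrite -[leLHS]mulr1 ler_pM ?ler1n.
Qed.

Lemma minimax_bound_dim_large : 0 <= alpha <= 1 -> (0 < n)%N -> (0 < d)%N ->
  delta <= 1 / 4 -> minimax_bound (1 / 24 * Num.sqrt (d%:R / n%:R)).
Proof.
move=> /andP[al0 al1] n0 d0 d4.
have dr : 0 < d%:R :> R by rewrite ltr0n.
have nr : 0 < n%:R :> R by rewrite ltr0n.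
have cT : #|[set: 'I_d]%SET| = d by rewrite cardsT card_ord.
set q : R := (4 * n%:R)^-1; have q0 : 0 < q by rewrite invr_gt0 mulr_gt0.
have q01 : 0 <= q <= 1.
  rewrite (ltW q0)/= invf_le1 ?mulr_gt0//.
  by rewrite -[leLHS]mulr1 ler_pM ?ler1n.
have sq0 : 0 < Num.sqrt q by rewrite sqrtr_gt0.
apply: (@cube_minimax_bound q (Num.sqrt q)^-1 (d%:R / 2) _ [set: 'I_d]%SET q01) => //.
(* The separation equals [Num.sqrt (q * (d%:R / 2))], the square root of [d / (8 n)]. *)
- rewrite -[X in _ <= _ * X * _](sqr_sqrtr (ltW q0)) expr2 mulKf ?gt_eqF//.
  rewrite -sqrtrM ?(ltW q0)// -[1 / 24]ger0_norm; last by lra.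
  rewrite -sqrtr_sqr -sqrtrM ?sqr_ge0// ler_sqrt; last first.
    by rewrite mulr_ge0 ?(ltW q0)// divr_ge0.
  rewrite (_ : q * _ = 1 / 8 * (d%:R / n%:R)); last by rewrite /q; field; rewrite gt_eqF.
  by rewrite ler_wpM2r ?divr_ge0//; lra.
- have := half_unseen_prob q01 (S := [set: 'I_d]%SET) (n := n); rewrite cT.
  by move=> H; apply: le_trans (H d0 (one_sub_quarter_ge n0)); lra.
- move=> c _; rewrite exprVn sqr_sqrtr ?(ltW q0)// => c2.
  apply: cube_moment_le1 => //; first by rewrite lerDl al0/=; lra.
  by rewrite mulrC -ler_pdivlMr// mul1r.
Qed.

Lemma minimax_bound_tail : 0 <= alpha <= 1 -> (0 < n)%N -> (0 < d)%N ->
  expR (- (n%:R / 4)) < delta < 1 / 4 ->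
  minimax_bound (1 / 24 * (ln (2 / delta) / n%:R) `^ (alpha / (1 + alpha))).
Proof.
move=> al01 n0 d0 /andP[dlo dhi]; have [al0 al1] := andP al01.
have nr : 0 < n%:R :> R by rewrite ltr0n.
have delta0 : 0 < delta by exact: lt_trans (expR_gt0 _) dlo.
have ln20 : 0 < ln 2 :> R by rewrite ln_gt0// ltr1n.
have lnlo : - (n%:R / 4) < ln delta by rewrite -ltr_expR lnK ?posrE.
have lnhi : ln delta < - (2 * ln 2).
  have -> : - (2 * ln 2) = ln (1 / 4) :> R.
    rewrite (_ : 1 / 4 = (2 * 2)^-1); last by field.
    by rewrite lnV ?posrE// lnM ?posrE//; ring.
  by rewrite ltr_ln ?posrE//; lra.
have ln2d : ln (2 / delta) = ln 2 - ln delta by rewrite ln_div ?posrE.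
(* [L] is chosen so that the coordinate stays unseen with probability exactly [2 * delta]; the lower
   bound on [delta] gives [L <= 1 / 4]. *)
pose L := - (ln 2 + ln delta) / n%:R.
have L0 : 0 < L by rewrite divr_gt0//; lra.
have L4 : L <= 1 / 4 by rewrite ler_pdivrMr//; lra.
pose q := 1 - expR (- L).
have qn : (1 - q) ^+ n = 2 * delta.
  rewrite /q subKr -expRM_natl /L (_ : _ * _ = ln 2 + ln delta).
    by rewrite expRD !lnK ?posrE.
  by field; rewrite gt_eqF.
(* From [1 + L <= expR L], [q] is at least [L / (1 + L)], and [1 + L <= 5 / 4]. *)
have qL : 4 / 5 * L <= q.
  have eL : 0 < expR L by exact: expR_gt0.
  have : (expR L)^-1 <= (1 + L)^-1.
    by rewrite lef_pV2 ?posrE ?expR_ge1Dx// addr_gt0.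
  rewrite /q expRN => H.
  have : (1 + L)^-1 <= 1 - 4 / 5 * L.
    rewrite -[leLHS]mul1r ler_pdivrMr ?addr_gt0//; nra.
  by lra.
have q0 : 0 < q by apply: lt_le_trans qL; exact: mulr_gt0.
have q1 : q <= 1 by rewrite gerBl expR_ge0.
pose S : {set 'I_d} := [set Ordinal d0]%SET.
have cS : #|S| = 1%N by rewrite cards1.
apply: (@sparse_minimax_bound q 1 _ S) => //.
- by rewrite cS.
- by rewrite cS mulr1.
- rewrite cS mulr1 divr1 sqrtr1 mulr1.
  set x := ln (2 / delta) / n%:R.
  have x0 : 0 <= x by rewrite divr_ge0// ln2d; lra.
  set b := alpha / (1 + alpha).
  have b01 : 0 <= b <= 1.
    by rewrite /b divr_ge0 ?addr_ge0//= ler_pdivrMr ?mul1r ?lerDr// ltr_pwDl.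
  have xb := powR_ge0 x b.
  have H : 4 / 15 * x `^ b <= q `^ b.
    apply: scaled_powR_le => //; first by lra.
    (* This is where [delta < 1 / 4] enters: it amounts to [ln delta <= - 2 * ln 2]. Then
       [4 / 15 * x <= 4 / 5 * L <= q]. *)
    have xL : x <= 3 * L.
      by rewrite /x /L ln2d mulrA ler_wpM2r ?invr_ge0//; lra.
    by lra.
  by lra.
- rewrite -qn -(@sample_weight_unseen R d q n (Ordinal d0)).
  apply: ler_sum => t _; rewrite ler_wpM2l//.
    by apply: sample_weight_ge0; rewrite (ltW q0).
  rewrite ler_nat; case: (boolP (_ \in _)) => // iU.
  rewrite lt0b ler1n; apply/card_gt0P; exists (Ordinal d0).
  by rewrite !inE eqxx andbT; move: iU; rewrite inE.
Qed.

End minimax.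

Theorem theorem1p3 (R : realType) (n d : nat) (alpha delta : R)
  (hn : (0 < n)%N) (hd : (1 <= d)%N) (halpha : 0 < alpha <= 1)
  (hdelta : expR (- (n%:R / 4)) < delta < 1 / 4) :
  exists F : set (probability 'rV[R]_d R),
    (forall D, F D -> weak_moment alpha D) /\
    forall muhat : {mfun n.-tuple 'rV[R]_d >-> 'rV[R]_d},
      exists D, F D /\
        (delta%:E <= iid D n [set X : n.-tuple 'rV[R]_d |
           (1 / 24 * Num.max (Num.max
               ((d%:R / n%:R) `^ (alpha / (1 + alpha)))
               (Num.sqrt (d%:R / n%:R)))
               ((ln (2 / delta) / n%:R) `^ (alpha / (1 + alpha)))
            <= enorm (muhat X - mean D))%R])%E.
Proof.
have al01 : 0 <= alpha <= 1 by case/andP: halpha => /ltW -> ->.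
have [al0 al1] := andP al01.
have /andP[_ /ltW d4] := hdelta.
rewrite -/(minimax_bound n d alpha delta _).
set b := alpha / (1 + alpha).
have b2 : b <= 2^-1 by rewrite /b ler_pdivrMr ?ltr_pwDl//; lra.
have nr : 0 < n%:R :> R by rewrite ltr0n.
have dr : 0 < d%:R :> R by rewrite ltr0n.
have x0 : 0 < d%:R / n%:R :> R by exact: divr_gt0.
have [_|_] := leP _ ((ln (2 / delta) / n%:R) `^ b); first exact: minimax_bound_tail.
(* Both remaining terms are powers of [d / n], with exponents [b <= 1 / 2] and [1 / 2]; which is
   larger depends on whether [d / n] is at most 1. *)
rewrite -(powR12_sqrt (ltW x0)); have [dn|nd] := leqP d n.
  rewrite max_l; first by apply: minimax_bound_dim_small => //; rewrite hd.
  by apply: ger_powR => //; rewrite x0 ler_pdivrMr// mul1r ler_nat.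
rewrite max_r; first by rewrite powR12_sqrt ?ltW//; exact: minimax_bound_dim_large.
by apply: ler_powR => //; rewrite ler_pdivlMr// mul1r ler_nat ltnW.
Qed.
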